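(* Let $\Sigma=(G,\sigma)$ be a connected signed graph of order $n$ and size $m$. Then $$s^{+}(\Sigma)\le 2m-n+1.$$
   Context: All graphs are finite, simple and undirected. For a graph $G=(V,E)$, the order is $n=|V|$ and the size is $m=|E|$. A signed graph is a pair $\Sigma=(G,\sigma)$, where $G$ is a graph and $\sigma:E(G)\to\{+1,-1\}$; its order and size are those of $G$, and $\Sigma$ is connected if $G$ is connected. The adjacency matrix $A(\Sigma)=(a_{uv})_{u,v\in V}$ is the real symmetric matrix with $a_{uv}=\sigma(uv)$ if $uv\in E(G)$ and $a_{uv}=0$ otherwise (in particular $a_{uu}=0$). Let $\lambda_1(\Sigma)\ge\cdots\ge\lambda_n(\Sigma)$ be the eigenvalues of $A(\Sigma)$ counted with multiplicity. The positive square energy is $s^{+}(\Sigma)=\sum_{\lambda_i(\Sigma)>0}\lambda_i(\Sigma)^2$. *)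

(* Defs.v *)
From mathcomp Require Import all_boot all_order all_algebra.
From mathcomp Require Import all_real_closed.
From mathcomp Require Import reals.

Set Implicit Arguments.
Unset Strict Implicit.
Unset Printing Implicit Defensive.

Import Order.TTheory GRing.Theory Num.Theory.
Local Open Scope ring_scope.

Record graph (V : finType) := Graph {
  edges : {set {set V}};
  card_edge : forall e, e \in edges -> #|e| = 2%N
}.

(* The values of [sign] outside [edges] are junk; nothing below reads them. *)
Record signed_graph (V : finType) := SignedGraph {
  underlying :> graph V;
  sign : {set V} -> int;
  sign_pm1 : forall e, e \in edges underlying -> sign e = 1 \/ sign e = -1
}.

Definition graph_order (V : finType) (G : graph V) : nat := #|V|.

Definition graph_size (V : finType) (G : graph V) : nat := #|edges G|.

Definition adj (V : finType) (G : graph V) : rel V :=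
  [rel u v | [set u; v] \in edges G].

Definition graph_connected (V : finType) (G : graph V) : Prop :=
  forall u v : V, connect (adj G) u v.

Definition adjacency_matrix (R : realType) (V : finType) (Sigma : signed_graph V) :
    'M[R]_#|V| :=
  \matrix_(i, j) let e := [set enum_val i; enum_val j] in
    if e \in edges Sigma then (sign Sigma e)%:~R else 0.

(* Nonincreasing list of the real eigenvalues of [A], each repeated according
   to its multiplicity as a root of the characteristic polynomial.  For a
   symmetric [A] this is the whole spectrum: see [char_poly_eigenvalues]. *)
Definition eigenvalues (R : realType) (n : nat) (A : 'M[R]_n) : seq R :=
  sort >=%R (flatten [seq nseq (mup x (char_poly A)) x
                     | x <- rootsR (char_poly A)]).

Definition positive_square_energy (R : realType) (V : finType)
    (Sigma : signed_graph V) : R :=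
  \sum_(x <- eigenvalues (adjacency_matrix R Sigma) | 0 < x) x ^+ 2.

Lemma tr_adjacency_matrix (R : realType) (V : finType) (Sigma : signed_graph V) :
  (adjacency_matrix R Sigma)^T = adjacency_matrix R Sigma.
Proof. by apply/matrixP => i j; rewrite !mxE setUC. Qed.

Lemma char_poly_symmetric_split (R : realType) (n : nat) (A : 'M[R]_n) :
  A^T = A -> exists s : seq R, char_poly A = \prod_(x <- s) ('X - x%:P).
Proof.
move=> symA; pose f := real_complex R; pose B := map_mx f A.
have realB : B \is a mxOver Num.real.
  by apply/mxOverP => i j; rewrite mxE; apply/complex_realP; exists (A i j).
have hermB : B \is hermsymmx.
  by apply: realsym_hermsym => //; apply/is_hermitianmxP; rewrite expr0 scale1r map_mx_id // /B map_trmx symA.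
have /orthomx_spectralP eqB := hermitian_normalmx hermB.
have /mxOverP reald := hermitian_spectral_diag_real hermB.
set d := spectral_diag B in eqB reald; set P := spectralmx B in eqB.
have uP : P \in unitmx := spectral_unit B.
have cpB : char_poly B = \prod_(i < n) ('X - (d 0 i)%:P).
  rewrite /char_poly /char_poly_mx eqB.
  pose Q := map_mx polyC P; pose Q' := map_mx polyC (invmx P).
  have QQ : Q' *m Q = 1%:M by rewrite -map_mxM mulVmx // map_mx1.
  have -> : 'X%:M - map_mx polyC (invmx P *m diag_mx d *m P)
      = Q' *m ('X%:M - map_mx polyC (diag_mx d)) *m Q.
    rewrite !map_mxM mulmxBr mulmxBl; congr (_ - _).
    by rewrite scalar_mxC -mulmxA QQ mulmx1.
  rewrite !det_mulmx mulrAC -det_mulmx QQ det1 mul1r.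
  rewrite -/(char_poly_mx _) -/(char_poly _) char_poly_trig.
    by apply: eq_bigr => i _; rewrite mxE eqxx mulr1n.
  exact/diag_mx_is_trig.
exists [seq complex.Re (d 0 i) | i <- enum 'I_n].
apply: (map_poly_inj (real_complex R : {rmorphism _ -> _})).
rewrite map_char_poly -/B cpB rmorph_prod /= big_map big_enum /=.
apply: eq_bigr => i _; rewrite rmorphB /= map_polyX map_polyC /=.
by rewrite RRe_real.
Qed.

Lemma char_poly_eigenvalues (R : realType) (n : nat) (A : 'M[R]_n) :
  A^T = A -> char_poly A = \prod_(x <- eigenvalues A) ('X - x%:P).
Proof.
move=> /char_poly_symmetric_split[s cpA]; rewrite cpA.
apply: perm_big; apply/allP => x _ /=; apply/eqP.
rewrite /eigenvalues (permP (permEl (perm_sort _ _))) cpA count_flatten.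
have p0 : \prod_(x <- s) ('X - x%:P) != 0 :> {poly R}.
  exact/monic_neq0/monic_prod_XsubC.
set r := rootsR _.
have ur : uniq r by apply: uniq_roots.
have rE : (x \in r) = (x \in s).
  by rewrite -(roots_on_rootsR p0) in_itv /= root_prod_XsubC.
rewrite -map_comp sumnE big_map.
transitivity (\sum_(y <- r) if y == x then count_mem x s else 0)%N; last first.
  apply: eq_bigr => y _ /=; rewrite count_nseq /= mu_prod_XsubC.
  by have [->|] := eqVneq y x; rewrite ?mul1n.
have [xr|xNr] := boolP (x \in r).
  rewrite (bigD1_seq x) //= eqxx big1 ?addn0 // => y.
  by move/negPf->.
rewrite big1_seq; first by apply/count_memPn; rewrite -rE.
by move=> y /= yr; case: eqP xNr => // <-; rewrite yr.
Qed.

Lemma size_eigenvalues (R : realType) (n : nat) (A : 'M[R]_n) :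
  A^T = A -> size (eigenvalues A) = n.
Proof.
move=> /char_poly_eigenvalues /(congr1 (fun p : {poly R} => size p)).
by rewrite size_char_poly size_prod_XsubC => -[].
Qed.

Lemma eigenvalues_nonincreasing (R : realType) (n : nat) (A : 'M[R]_n) :
  sorted >=%R (eigenvalues A).
Proof. by apply: sort_sorted => x y; apply: ge_total. Qed.

(* Main.v *)
(* Let A be the signed adjacency matrix and A_- its negative part. As the sum of
   the squared eigenvalues is 2m, the claim is |A_-|_F^2 >= n - 1, and A_- = A_+ - A
   with A_+ positive semidefinite; in fact |X - A|_F^2 >= n - 1 for every positive
   semidefinite X. Only the entries t = sign * X_uv on the edges matter: adding to
   the Hadamard square of X the Laplacian with weights X_uv^2 on the non-edges
   gives a positive semidefinite matrix S supported on the diagonal and the edges,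
   with S_uv = t_uv^2, and |X - A|_F^2 = tr S + sum (1 - t_uv)^2 over ordered edges.

   That this is at least n - 1 for every such S and t on a connected graph is shown
   by induction on n. At a cut vertex, S splits into two such matrices. If there is
   none and 2m <= (n - 1)^2, averaging over all vertex deletions suffices. Otherwise
   the graph has a proper colouring with k <= n colours where 2m >= k (n - 1):
   k = n for a complete graph, k = n - 1 otherwise, two non-adjacent vertices sharing
   a colour; testing S on a simplex indexed by the colours then gives the bound
   2m / k. *)

Require Import Defs.
From mathcomp Require Import all_boot all_order all_algebra.
From mathcomp Require Import all_real_closed.
From mathcomp Require Import reals.
From mathcomp Require Import zify ring lra.

Set Implicit Arguments.
Unset Strict Implicit.
Unset Printing Implicit Defensive.

Import Order.TTheory GRing.Theory Num.Theory.
Local Open Scope ring_scope.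

(** * Sums over the vertices and edges of an induced subgraph *)

Section Energy.

Variables (R : realType) (I : finType) (e : rel I).
Hypotheses (e_sym : symmetric e) (e_irr : irreflexive e).
Implicit Types (U W A B : {set I}) (h f mu : I -> R) (g t : I -> I -> R).

(* Every edge is counted twice in the second sum, once per orientation. *)
Definition energy U h g : R :=
  \sum_(x in U) h x + \sum_(x in U) \sum_(y in U | e x y) g x y.

(** Connectedness of the subgraph induced on [U], phrased through cuts instead of paths, as this
    form passes easily to the two sides of a cut vertex. *)
Definition cut_connected U :=
  forall A, A \proper U -> A != set0 ->
  exists x y, [/\ x \in A, y \in U :\: A & e x y].

(** Positive semidefiniteness on [U] of the matrix S with diagonal [mu], entries [t x y ^+ 2] on the
    edges and 0 elsewhere. *)
Definition psd U mu t := forall f,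
  0 <= energy U (fun x => mu x * f x ^+ 2) (fun x y => t x y ^+ 2 * f x * f y).

Lemma energyE U h g : energy U h g =
  \sum_x (if x \in U then h x else 0)
  + \sum_x \sum_y (if [&& x \in U, y \in U & e x y] then g x y else 0).
Proof.
rewrite /energy big_mkcond; congr (_ + _); rewrite big_mkcond.
by apply: eq_bigr => x _; case: (x \in U) => /=; rewrite ?big1_eq // big_mkcond.
Qed.

Lemma energy0 U g :
  energy U (fun=> 0) g = \sum_(x in U) \sum_(y in U | e x y) g x y.
Proof. by rewrite /energy big1 // add0r. Qed.

Lemma eq_energy U h1 h2 g1 g2 :
  {in U, h1 =1 h2} ->
  {in U &, forall x y, e x y -> g1 x y = g2 x y} ->
  energy U h1 g1 = energy U h2 g2.
Proof.
move=> eqh eqg; congr (_ + _); first exact: eq_bigr.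
by apply: eq_bigr => x xU; apply: eq_bigr => y /andP[yU exy]; apply: eqg.
Qed.

Lemma energyD U h1 h2 g1 g2 :
  energy U (fun x => h1 x + h2 x) (fun x y => g1 x y + g2 x y)
  = energy U h1 g1 + energy U h2 g2.
Proof.
rewrite /energy big_split /= addrACA; congr (_ + _).
by rewrite -big_split; apply: eq_bigr => x _; rewrite big_split.
Qed.

Lemma energyZ U a h g :
  energy U (fun x => a * h x) (fun x y => a * g x y) = a * energy U h g.
Proof.
rewrite /energy mulrDr !mulr_sumr; congr (_ + _).
by apply: eq_bigr => x _; rewrite mulr_sumr.
Qed.

Lemma energy_sum (J : finType) (K : {set J}) U
    (h : J -> I -> R) (g : J -> I -> I -> R) :
  energy U (fun x => \sum_(i in K) h i x) (fun x y => \sum_(i in K) g i x y)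
  = \sum_(i in K) energy U (h i) (g i).
Proof.
rewrite /energy big_split /= exchange_big; congr (_ + _).
rewrite exchange_big; apply: eq_bigr => x _; exact: exchange_big.
Qed.

Lemma psd_sub U W mu t : W \subset U -> psd U mu t -> psd W mu t.
Proof.
move=> /subsetP sWU psdU f; have := psdU (fun x => if x \in W then f x else 0).
congr (_ <= _); rewrite !energyE; congr (_ + _).
  apply: eq_bigr => x _; have [/sWU->//|_] := boolP (x \in W).
  by case: ifP; rewrite // expr0n mulr0.
apply: eq_bigr => x _; apply: eq_bigr => y _.
have [/sWU->|_] := boolP (x \in W); have [/sWU->|_] := boolP (y \in W) => //=;
by case: ifP; rewrite // ?(mulr0, mul0r).
Qed.

(** Makes the hypotheses stable under [t] becoming [a * t], so that the averaging argument may
    choose the best [a]. *)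
Lemma psd_scale U mu t a :
  psd U mu t -> psd U (fun x => a ^+ 2 * mu x) (fun x y => a * t x y).
Proof.
move=> psdU f; have := mulr_ge0 (sqr_ge0 a) (psdU f); rewrite -energyZ.
by congr (_ <= _); apply: eq_energy => [x _|x y _ _ _]; ring.
Qed.

Lemma psd_diag_ge0 U mu t x : psd U mu t -> x \in U -> 0 <= mu x.
Proof.
move=> psdU xU; have := psdU (fun y => (y == x)%:R); rewrite /energy.
rewrite (bigD1 x) //= eqxx expr1n mulr1 big1 => [|y /andP[_ /negPf->]]; last first.
  by rewrite expr0n mulr0.
rewrite addr0 big1 ?addr0 // => y _; rewrite big1 // => z /andP[_ eyz].
have [yx|] := eqVneq y x; last by rewrite mulr0 mul0r.
have [zx|] := eqVneq z x; last by rewrite mulr0.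
by move: eyz; rewrite yx zx e_irr.
Qed.

(** * Cut vertices, vertex deletions and colourings *)

(** With no edge between [A] and the rest of [U :\ v], every term belongs to exactly one side,
    except [h v], which belongs to both. *)
Lemma energy_split U A v h g :
    v \in U -> A \subset U :\ v ->
    (forall x y, x \in A -> y \in (U :\ v) :\: A -> ~~ e x y) ->
  energy U h g = energy (v |: A) h g + energy (U :\: A) h g - h v.
Proof.
move=> vU /subsetP sAU noe.
have vA : v \notin A by apply/negP => /sAU; rewrite !inE eqxx.
have AU x : x \in A -> x \in U by move/sAU; rewrite inE => /andP[].
have -> : h v = \sum_x if x == v then h x else 0.
  by rewrite -big_mkcond big_pred1_eq.
have regroup (p1 q1 p2 q2 k : R) :
  p1 + q1 + (p2 + q2) - k = (p1 + p2 - k) + (q1 + q2) by ring.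
rewrite !energyE regroup; congr (_ + _).
  rewrite -big_split -sumrB; apply: eq_bigr => x _; rewrite !inE /=.
  have [->|xv] := eqVneq x v; first by rewrite vU vA /=; ring.
  by have [/AU->|_] := boolP (x \in A) => /=; rewrite subr0 ?addr0 ?add0r.
rewrite -big_split; apply: eq_bigr => x _; rewrite -big_split.
apply: eq_bigr => y _ /=; rewrite !inE.
have [exy|] := boolP (e x y); last by rewrite !andbF addr0.
have [xv|xv] := eqVneq x v; have [yv|yv] := eqVneq y v.
- by rewrite xv yv e_irr in exy.
- rewrite xv vU vA /=; have [/AU->|_] := boolP (y \in A); rewrite /= ?addr0 ?add0r //.
- rewrite yv vU vA /=; have [/AU->|_] := boolP (x \in A); rewrite /= ?addr0 ?add0r //.
have [xA|xA] := boolP (x \in A); have [yA|yA] := boolP (y \in A) => /=.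
- by rewrite !AU // addr0.
- have [yU|_] := boolP (y \in U); last by rewrite /= ?andbF addr0.
  by move: (noe x y xA); rewrite !inE yU yA yv exy => /(_ isT).
- have [xU|_] := boolP (x \in U); last by rewrite /= ?andbF addr0.
  by move: (noe y x yA); rewrite !inE xU xA xv e_sym exy => /(_ isT).
- by rewrite add0r.
Qed.

Lemma energy_setD1 U v h g : v \in U -> (forall x y, g x y = g y x) ->
  energy (U :\ v) h g = energy U h g - h v - 2 * \sum_(y in U | e v y) g v y.
Proof.
move=> vU g_sym; rewrite /energy [in RHS](bigD1 v) //=.
have -> : \sum_(x in U) \sum_(y in U | e x y) g x y =
    \sum_(y in U | e v y) g v y
    + \sum_(i in U | i != v) \sum_(y in U | e i y) g i y by rewrite (bigD1 v).
have -> : \sum_(i in U | i != v) \sum_(y in U | e i y) g i y =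
    \sum_(i in U | i != v) (\sum_(y in U :\ v | e i y) g i y
      + (if e v i then g v i else 0)).
  apply: eq_bigr => x /andP[xU xv]; have [evx|evx] := boolP (e v x).
    rewrite (bigD1 v) /=; last by rewrite vU e_sym.
    rewrite addrC [g x v]g_sym; congr (_ + _); apply: eq_bigl => y.
    by rewrite !inE; case: (y != v); rewrite /= ?andbT ?andbF.
  rewrite addr0; apply: eq_bigl => y; rewrite !inE.
  have [->|//] := eqVneq y v; by rewrite e_sym (negPf evx) andbF.
rewrite big_split /=.
have -> : \sum_(i in U | i != v) (if e v i then g v i else 0)
    = \sum_(y in U | e v y) g v y.
  rewrite -big_mkcondr; apply: eq_bigl => y.
  by have [->|] := eqVneq y v; rewrite ?e_irr ?andbF ?andbT.
have eqU x : (x \in U :\ v) = (x \in U) && (x != v) by rewrite !inE andbC.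
rewrite !(eq_bigl _ _ eqU); ring.
Qed.

Lemma sum_energy_setD1 U h g : (forall x y, g x y = g y x) ->
  \sum_(v in U) energy (U :\ v) h g =
  #|U|%:R * energy U h g - \sum_(v in U) h v
  - 2 * \sum_(v in U) \sum_(y in U | e v y) g v y.
Proof.
move=> g_sym; under eq_bigr => v vU do rewrite energy_setD1 //.
by rewrite !sumrB sumr_const mulr_sumr mulr_natl.
Qed.

Lemma energy_ge0 U h g : {in U, forall x, 0 <= h x} ->
  (forall x y, 0 <= g x y) -> 0 <= energy U h g.
Proof.
move=> h0 g0; apply: addr_ge0; first exact: sumr_ge0.
by apply: sumr_ge0 => x _; apply: sumr_ge0 => y _; apply: g0.
Qed.

Lemma energy_update U v d h g : v \in U ->
  energy U (fun x => h x + if x == v then d else 0) g = energy U h g + d.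
Proof.
move=> vU; rewrite /energy big_split /= -big_mkcondr.
rewrite (big_pred1 v) => [|x]; first by ring.
by have [->|] := eqVneq x v; rewrite ?vU ?andbF /= ?eqxx // => /negPf->.
Qed.

(** An edge of [U] with an end in [A] stays inside [v |: A]. A cut [B] of this piece is therefore
    crossed by an edge leaving [B] if [v] is outside [B], and by one leaving the complement of [B]
    in the piece otherwise. *)
Lemma cut_connected_piece U A v :
    cut_connected U -> v \in U -> A \subset U :\ v ->
    (forall x y, x \in A -> y \in (U :\ v) :\: A -> ~~ e x y) ->
  cut_connected (v |: A).
Proof.
move=> cU vU /subsetP sAU noe B /properP[/subsetP sB [b bA bB]] B0.
have AU x : x \in A -> x \in U by move/sAU; rewrite inE => /andP[].
have vA : v \notin A by apply/negP => /sAU; rewrite !inE eqxx.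
have toA x y : x \in A -> y \in U -> e x y -> y \in v |: A.
  move=> xA yU exy; rewrite !inE; have [//|yv] := eqVneq y v.
  by apply: contraTT exy => yA; apply: (noe x y); rewrite // !inE yA yv.
have [vB|vB] := boolP (v \in B).
  have sC : {subset (v |: A) :\: B <= A}.
    by move=> x; rewrite !inE => /andP[xB /orP[/eqP xv|//]]; rewrite xv vB in xB.
  have [||x [y [xC]]] := cU ((v |: A) :\: B).
  - apply/properP; split; first by apply/subsetP => x /sC/AU.
    by exists v; rewrite // !inE vB.
  - by apply/set0Pn; exists b; rewrite inE bB.
  rewrite !inE => /andP[yC yU] exy; have := toA x y (sC _ xC) yU exy.
  exists y, x; split; last by rewrite e_sym.
    by move: yC H; rewrite !inE negb_and negbK => /orP[//|/negP nyA /nyA].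
  by move: xC; rewrite !inE andbC.
have sBA : {subset B <= A}.
  by move=> x xB; have := sB x xB; rewrite !inE => /orP[/eqP xv|//]; rewrite -xv xB in vB.
have [||x [y [xB]]] := cU B.
- apply/properP; split; first by apply/subsetP => x /sBA/AU.
  by exists v.
- by [].
rewrite inE => /andP[yB yU] exy; exists x, y; split=> //.
by rewrite inE yB (toA x y) ?sBA.
Qed.

(* The diagonal entry at a cut vertex [v] is shared out between the two sides:
   [a] is the infimum of the form on [v |: A] over the vectors with value 1 at [v],
   here written as the supremum of the lower bounds given by the other side. *)
Lemma psd_split U A v mu t :
    v \in U -> A \subset U :\ v ->
    (forall x y, x \in A -> y \in (U :\ v) :\: A -> ~~ e x y) ->
    psd U mu t ->
  exists a, psd (v |: A) (fun x => mu x + if x == v then - a else 0) t /\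
            psd (U :\: A) (fun x => mu x + if x == v then a - mu v else 0) t.
Proof.
move=> vU sA noe psdU.
have vA : v \notin A by apply/negP => /(subsetP sA); rewrite !inE eqxx.
pose q W f := energy W (fun x => mu x * f x ^+ 2) (fun x y => t x y ^+ 2 * f x * f y).
(* The form of [U] is tested on [f] and [f'] glued along [v]; the diagonal term at [v] then occurs
   in both pieces. *)
have glue f f' : f v = f' v -> mu v * f v ^+ 2 <= q (v |: A) f + q (U :\: A) f'.
  move=> ff'; have := psdU (fun x => if x \in v |: A then f x else f' x).
  rewrite (energy_split _ _ vU sA noe) !inE eqxx /= subr_ge0.
  congr (_ <= _ + _); apply: eq_energy => [x xA|x y xA yA _]; rewrite ?xA ?yA //.
    by move: xA; rewrite !inE; case: eqVneq => [->|_] /andP[/negPf-> _] //=; rewrite ff'.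
  by move: xA yA; rewrite !inE; case: eqVneq => [->|_] /andP[/negPf-> _];
    case: eqVneq => [->|_] /andP[/negPf-> _] //=; rewrite ff'.
have qZ W f c : q W (fun x => c * f x) = c ^+ 2 * q W f.
  by rewrite -energyZ; apply: eq_energy => [x _|x y _ _ _]; ring.
have q_ge0 W f : W \subset U -> 0 <= q W f.
  by move=> sW; apply: (psd_sub sW psdU).
pose E := classical_sets.mkset
  (fun r => exists2 f, f v = 1 & r = mu v - q (U :\: A) f).
have ubE f : f v = 1 -> classical_sets.ubound E (q (v |: A) f).
  move=> fv _ [f' f'v ->]; rewrite lerBlDr.
  by have := glue f f'; rewrite fv f'v expr1n mulr1 => /(_ erefl).
have E0 : classical_sets.nonempty E by exists (mu v - q (U :\: A) (fun=> 1)), (fun=> 1).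
have supE : classical_sets.has_sup E by split=> //; exists (q (v |: A) (fun=> 1)); apply: ubE.
(* A lower bound [b] over the vectors with value 1 at [v] allows the diagonal entry at [v] to drop
   by [b]: nonzero values at [v] reduce to 1 by homogeneity, and at value 0 the entry does not
   matter. *)
have rescale W c (b : R) : W \subset U -> v \in W ->
    (forall f, f v = 1 -> b <= q W f) -> c = - b ->
    psd W (fun x => mu x + if x == v then c else 0) t.
  move=> sW vW bq -> f.
  have -> : energy W (fun x => (mu x + (if x == v then - b else 0)) * f x ^+ 2)
      (fun x y => t x y ^+ 2 * f x * f y) = q W f - b * f v ^+ 2.
    rewrite -mulNr -(energy_update _ _ _ vW); apply: eq_energy => // x _.
    by rewrite mulrDl; case: eqVneq => [->|] //; rewrite mul0r.
  have [->|fv] := eqVneq (f v) 0; first by rewrite expr0n mulr0 subr0 q_ge0.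
  have := bq (fun x => (f v)^-1 * f x) (mulVf fv); rewrite qZ => bqf.
  rewrite subr_ge0 mulrC -(ler_pM2l (_ : 0 < (f v ^+ 2)^-1)).
    by rewrite mulrA mulVf ?expf_eq0 //= mul1r -exprVn.
  by rewrite invr_gt0 exprn_even_gt0.
have sB : U :\: A \subset U by apply/subsetP => x; rewrite inE => /andP[].
exists (sup E); split.
  apply: (@rescale _ _ (sup E)) => //; first 2 last.
  - by move=> f fv; apply: ge_sup => //; apply: ubE.
  - apply/subsetP => x; rewrite !inE => /orP[/eqP->//|/(subsetP sA)].
    by rewrite inE => /andP[].
  by rewrite !inE eqxx.
apply: (@rescale _ _ (mu v - sup E)) => //; last by rewrite opprB.
  by rewrite inE vA.
move=> f fv; rewrite lerBlDr -lerBlDl; apply: ub_le_sup; first exact: supE.2.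
by exists f.
Qed.

(* Test vectors 1 - k 1_(c = i), one for each of the k colours i: as i varies they
   form a simplex with one vertex per colour. *)
Lemma psd_coloring (J : finType) (K : {set J}) (c : I -> J) U mu t :
    psd U mu t -> {in U, forall x, c x \in K} ->
    {in U &, forall x y, e x y -> c x != c y} -> (0 < #|K|)%N ->
  0 <= energy U (fun x => (#|K|%:R - 1) * mu x) (fun x y => - t x y ^+ 2).
Proof.
move=> psdU cK proper_c K0; set k : R := #|K|%:R.
have k0 : 0 < k by rewrite ltr0n.
pose f i x : R := 1 - k * (c x == i)%:R.
have delta (a : J) : a \in K -> \sum_(i in K) (a == i)%:R = 1 :> R.
  move=> aK; rewrite (bigD1 a) //= eqxx big1 ?addr0 // => i /andP[_].
  by rewrite eq_sym => /negPf->.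
(* The Gram matrix of the simplex: k (k - 1) for equal colours, - k for different ones. *)
have dot x y : x \in U -> y \in U ->
    \sum_(i in K) f i x * f i y = k ^+ 2 * (c x == c y)%:R - k.
  move=> xU yU; transitivity (\sum_(i in K)
      (1 - k * (c x == i)%:R - k * (c y == i)%:R
       + k ^+ 2 * (c x == c y)%:R * (c x == i)%:R)).
    apply: eq_bigr => i _; rewrite /f; have [<-|] := eqVneq (c x) i.
      by rewrite [c y == _]eq_sym mulr1n; ring.
    by move=> _; rewrite mulr0n; ring.
  rewrite big_split /= !sumrB sumr_const -!mulr_sumr !delta ?cK //.
  by rewrite -/k; ring.
rewrite -(pmulr_rge0 _ k0) -energyZ.
have := sumr_ge0 (index_enum J) (fun i (_ : i \in K) => psdU (f i)).
rewrite -energy_sum; congr (_ <= _); apply: eq_energy => [x xU|x y xU yU exy].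
  rewrite -mulr_sumr; under eq_bigr do rewrite expr2.
  by rewrite dot // eqxx mulr1n; ring.
under eq_bigr do rewrite -mulrA.
by rewrite -mulr_sumr dot // (negPf (proper_c x y xU yU exy)) mulr0n; ring.
Qed.

(** On each edge (k - 1) (k (1 - t)^2 - 1) = (k t - (k - 1))^2 - k t^2, so k times the inequality of
    [psd_coloring] plus a sum of squares gives the claim multiplied by k - 1. *)
Lemma energy_coloring (J : finType) (K : {set J}) (c : I -> J) U mu t :
    psd U mu t -> {in U, forall x, c x \in K} ->
    {in U &, forall x y, e x y -> c x != c y} -> (1 < #|K|)%N ->
  energy U (fun=> 0) (fun _ _ => 1)
    <= #|K|%:R * energy U mu (fun x y => (1 - t x y) ^+ 2).
Proof.
move=> psdU cK proper_c K1.
have := psd_coloring psdU cK proper_c (ltnW K1); set k : R := #|K|%:R => colored.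
have k1 : 0 < k - 1 by rewrite subr_gt0 ltr1n.
have sq : 0 <= energy U (fun=> 0) (fun x y => (k * t x y - (k - 1)) ^+ 2).
  by apply: energy_ge0 => // x y; apply: sqr_ge0.
rewrite -subr_ge0 -(pmulr_rge0 _ k1).
have : 0 <= k * energy U (fun x => (k - 1) * mu x) (fun x y => - t x y ^+ 2)
    + energy U (fun=> 0) (fun x y => (k * t x y - (k - 1)) ^+ 2).
  by rewrite addr_ge0 // mulr_ge0 // ler0n.
congr (_ <= _); rewrite mulrBr mulrA -!mulNr -!energyZ -!energyD.
by apply: eq_energy => [x _|x y _ _ _]; ring.
Qed.

(** * Averaging over the vertex deletions *)

Lemma cut_connected_nbr U x : cut_connected U -> x \in U -> (1 < #|U|)%N ->
  exists2 y, y \in U & e x y.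
Proof.
move=> cU xU U1; have [||_ [y [/set1P-> yU exy]]] := cU [set x].
- by rewrite properEcard sub1set xU cards1.
- by apply/set0Pn; exists x; rewrite inE.
by exists y => //; move: yU; rewrite inE => /andP[].
Qed.

Lemma energy_ge_card U : cut_connected U -> (1 < #|U|)%N ->
  #|U|%:R <= energy U (fun=> 0) (fun _ _ => 1).
Proof.
move=> cU U1; rewrite energy0 -sumr_const.
apply: ler_sum => x xU; have [y yU exy] := cut_connected_nbr cU xU U1.
by rewrite (bigD1 y) ?yU //= lerDl sumr_ge0.
Qed.

Lemma energy_sqr_expand U mu t a :
  energy U (fun x => a ^+ 2 * mu x) (fun x y => (1 - a * t x y) ^+ 2) =
  a ^+ 2 * energy U mu (fun x y => t x y ^+ 2)
  - 2 * a * energy U (fun=> 0) t + energy U (fun=> 0) (fun _ _ => 1).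
Proof.
rewrite -mulNr -!energyZ -!energyD.
by apply: eq_energy => [x _|x y _ _ _]; ring.
Qed.

(** The edge sum of (t - r)^2 is nonnegative for every r; the choice r = s / M gives the
    inequality. *)
Lemma energy_cauchy U t :
  energy U (fun=> 0) t ^+ 2 <=
  energy U (fun=> 0) (fun _ _ => 1) * energy U (fun=> 0) (fun x y => t x y ^+ 2).
Proof.
set M := energy U _ (fun _ _ => 1); set s := energy U _ t.
set a := energy U _ _.
have M0 : 0 <= M by apply: energy_ge0.
have pos r : 0 <= a - 2 * r * s + r ^+ 2 * M.
  have : 0 <= energy U (fun=> 0) (fun x y => (t x y - r) ^+ 2).
    by apply: energy_ge0 => // x y; apply: sqr_ge0.
  congr (_ <= _); rewrite -mulNr -!energyZ -!energyD.
  by apply: eq_energy => [x _|x y _ _ _]; ring.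
have [M_eq0|M_neq0] := eqVneq M 0.
  rewrite M_eq0 mul0r; have [->|s0] := eqVneq s 0; first by rewrite expr0n.
  (* If M = 0 and s is nonzero, this r makes the nonnegative quantity equal to -1. *)
  have := pos ((a + 1) / (2 * s)); rewrite M_eq0 mulr0 addr0.
  suff -> : 2 * ((a + 1) / (2 * s)) * s = a + 1 by rewrite opprD addNKr lerNr oppr0 ler10.
  by field.
have Mgt0 : 0 < M by rewrite lt_def M_neq0.
have := mulr_ge0 M0 (pos (s / M)).
suff -> : M * (a - 2 * (s / M) * s + (s / M) ^+ 2 * M) = M * a - s ^+ 2.
  by rewrite subr_ge0.
by field.
Qed.

(* The bounds for the n sets [U :\ v] add up to (n - 1) F >= n (n - 2) + S with
   S the sum of the (1 - t)^2; Cauchy-Schwarz bounds S below by F^2 / M, M the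
   number of ordered edges, once t has been scaled to minimise F. *)
Lemma energy_averaging U mu t :
    (forall x y, t x y = t y x) -> cut_connected U -> psd U mu t ->
    (2 < #|U|)%N ->
    energy U (fun=> 0) (fun _ _ => 1) <= (#|U|%:R - 1) ^+ 2 ->
    (forall a v, v \in U -> #|U|%:R - 2 <=
       energy (U :\ v) (fun x => a ^+ 2 * mu x) (fun x y => (1 - a * t x y) ^+ 2)) ->
  #|U|%:R - 1 <= energy U mu (fun x y => (1 - t x y) ^+ 2).
Proof.
move=> t_sym cU psdU U2 Msmall IH.
have := energy_ge_card cU (ltnW U2).
set M := energy U _ (fun _ _ => 1) in Msmall *; set n : R := #|U|%:R in Msmall IH *.
move=> nM; have n3 : 3 <= n by rewrite ler_nat.
have M_ge0 : 0 <= M by lra.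
set D := energy U mu (fun x y => t x y ^+ 2).
set s := energy U (fun=> 0) t.
have sD : s ^+ 2 <= M * D.
  apply: le_trans (energy_cauchy U t) _; apply: ler_wpM2l => //.
  rewrite energy0 /D /energy lerDr; apply: sumr_ge0 => x xU.
  exact: psd_diag_ge0 psdU xU.
(* [a] minimises a^2 D - 2 a s + M, with minimum [V]. If D = 0, division by zero gives a = 0, and
   [sD] forces s = 0. *)
pose a := s / D; pose V := M - a * s.
have aD : a ^+ 2 * D = a * s.
  have [D0|D0] := eqVneq D 0; last by rewrite /a; field.
  by rewrite /a D0 invr0 !(mulr0, mul0r).
have aE : a * D = s.
  have [D0|D0] := eqVneq D 0; last by rewrite /a; field.
  by move: sD; rewrite D0 !mulr0 => sqs; apply/esym/eqP; rewrite -sqrf_eq0 eq_le sqs sqr_ge0.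
have VE : energy U (fun x => a ^+ 2 * mu x) (fun x y => (1 - a * t x y) ^+ 2) = V.
  by rewrite energy_sqr_expand -/M -/s -/D aD /V; ring.
have D0 : 0 <= D.
  rewrite /D addr_ge0 //; apply: sumr_ge0 => x xU; first exact: psd_diag_ge0 psdU xU.
  by apply: sumr_ge0 => y _; apply: sqr_ge0.
have leV : V <= energy U mu (fun x y => (1 - t x y) ^+ 2).
  have -> : energy U mu (fun x y => (1 - t x y) ^+ 2) = D - 2 * s + M.
    have := energy_sqr_expand U mu t 1; rewrite expr1n mul1r mulr1 -/D -/s -/M => <-.
    by apply: eq_energy => [x _|x y _ _ _]; ring.
  have : 0 <= (a - 1) ^+ 2 * D by rewrite mulr_ge0 ?sqr_ge0.
  have -> : (a - 1) ^+ 2 * D = a ^+ 2 * D - 2 * (a * D) + D by ring.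
  by rewrite aD aE /V; lra.
apply: le_trans leV; rewrite leNgt; apply/negP => Vlt.
pose S := energy U (fun=> 0) (fun x y => (1 - a * t x y) ^+ 2).
have SV : V ^+ 2 <= M * S.
  have := energy_cauchy U (fun x y => 1 - a * t x y); rewrite -/M -/S.
  congr (_ ^+ 2 <= _); rewrite /V /M /s -mulNr -energyZ -energyD.
  by apply: eq_energy => [x _|x y _ _ _]; ring.
(* A vertex term is lost in one deletion, an edge term in two. As V is the vertex sum plus S, what
   remains is n V - (V - S) - 2 S. *)
have sumIH : n * (n - 2) <= (n - 1) * V - S.
  have : \sum_(v in U) (n - 2) <= \sum_(v in U)
      energy (U :\ v) (fun x => a ^+ 2 * mu x) (fun x y => (1 - a * t x y) ^+ 2).
    by apply: ler_sum => v vU; apply: IH.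
  rewrite sumr_const -[_ *+ #|U|]mulr_natl sum_energy_setD1 => [|x y]; last by rewrite t_sym.
  rewrite -/n VE => /le_trans; apply.
  have -> : V = \sum_(v in U) a ^+ 2 * mu v + S.
    by rewrite -VE /S energy0.
  by rewrite /S energy0; lra.
have : M * S <= M * ((n - 1) * V - n * (n - 2)) by apply: ler_wpM2l; lra.
move=> /(le_trans SV) quad.
(* The product expands to V^2 - M (n - 1) V + (n - 1)^2 (M - 1), which is at most M - (n - 1)^2 by
   [quad], hence at most 0 by [Msmall]. *)
have : 0 < (n - 1 - V) * (M * (n - 1) - (n - 1) - V).
  apply: mulr_gt0; first lra.
  by have := ler_wpM2r (_ : 0 <= n - 1) nM; nra.
by nra.
Qed.

(** * Induction on the number of vertices *)

Theorem energy_bound U mu t :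
    (forall x y, t x y = t y x) -> cut_connected U -> psd U mu t ->
  #|U|%:R - 1 <= energy U mu (fun x y => (1 - t x y) ^+ 2).
Proof.
have [m] := ubnP #|U|; elim: m => // m IH in U mu t *.
rewrite ltnS => Um t_sym cU psdU.
have [U1|U1] := leqP #|U| 1.
  apply: (@le_trans _ _ 0); first by rewrite subr_le0 lern1.
  by apply: energy_ge0 => [x|x y]; [exact: psd_diag_ge0 | exact: sqr_ge0].
have [|nocut] := boolP [exists v in U, exists A : {set I},
    [&& A \subset U :\ v, A != set0, A != U :\ v &
     [forall x in A, forall y in (U :\ v) :\: A, ~~ e x y]]].
  move=> /exists_inP[v vU /existsP[A /and4P[sA A0 AU /forall_inP noe0]]].
  have noe x y : x \in A -> y \in (U :\ v) :\: A -> ~~ e x y.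
    by move=> /noe0/forall_inP; apply.
  have vA : v \notin A by apply/negP => /(subsetP sA); rewrite !inE eqxx.
  have UA : U :\: A = v |: ((U :\ v) :\: A).
    apply/setP => x; rewrite !inE; have [->|] := eqVneq x v; by rewrite ?vA ?vU.
  have ltA : (#|A| < #|U :\ v|)%N by rewrite proper_card // properEneq AU.
  have cardA := cardsD U A; have cardv := cardsD1 v U.
  have UIA : U :&: A = A.
    by apply/setIidPr/(subset_trans sA); apply: subD1set.
  rewrite UIA in cardA; rewrite vU in cardv.
  have A_gt0 : (0 < #|A|)%N by rewrite card_gt0.
  have [a [psd1 psd2]] := psd_split vU sA noe psdU.
  have c1 := cut_connected_piece cU vU sA noe.
  have c2 : cut_connected (U :\: A).
    rewrite UA; apply: (cut_connected_piece cU vU); first exact: subsetDl.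
    move=> x y; rewrite !inE negb_and negbK => /and3P[xA xv xU] /and3P[yA yv yU].
    rewrite e_sym; apply: noe; last by rewrite !inE xA xv.
    by move: yA; rewrite yv yU /= => /orP[].
  have vUA : v \in U :\: A by rewrite inE vA.
  have card1 : #|v |: A| = #|A|.+1 by rewrite cardsU1 vA.
  have lt1 : (#|v |: A| < m)%N by lia.
  have lt2 : (#|U :\: A| < m)%N by lia.
  (* The pieces have [#|U|] + 1 vertices together, so the two bounds add up to [#|U|] - 1; the
     shifts - a and a - [mu v] cancel the second copy of [mu v]. *)
  have := lerD (IH _ _ _ lt1 t_sym c1 psd1) (IH _ _ _ lt2 t_sym c2 psd2).
  rewrite !energy_update ?vUA ?setU11 // (energy_split _ _ vU sA noe).
  have sA' : (#|A| <= #|U|)%N by lia.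
  rewrite cardA card1 natrB // -addn1 natrD.
  by lra.
(* A cut of [U :\ v] crossed by no edge would make [v] a cut vertex. *)
have cD v : v \in U -> cut_connected (U :\ v).
  move=> vU A /andP[sA nA] A0.
  have [/exists_inP[x xA /exists_inP[y yA exy]]|noedge] :=
    boolP [exists x in A, exists y in (U :\ v) :\: A, e x y]; first by exists x, y.
  case/negP: nocut; apply/exists_inP; exists v => //; apply/existsP; exists A.
  rewrite sA A0 /=; apply/andP; split.
    by apply: contraNneq nA => ->.
  apply/forall_inP => x xA; apply/forall_inP => y yA.
  apply: contra noedge => exy.
  by apply/exists_inP; exists x => //; apply/exists_inP; exists y.
have U0 : 0 < #|U|%:R :> R by rewrite ltr0n; lia.
have [/existsP[x /existsP[z /and4P[xU zU xz nexz]]]|complete] :=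
    boolP [exists x, exists z, [&& x \in U, z \in U, x != z & ~~ e x z]]; last first.
  (* Complete graph: each vertex is its own colour, so k = n and M = n (n - 1). *)
  have := @energy_coloring _ U id _ _ _ psdU (fun _ => id) _ U1.
  have -> : energy U (fun=> 0) (fun _ _ => 1) = #|U|%:R * (#|U|%:R - 1).
    rewrite energy0 mulr_natl -sumr_const; apply: eq_bigr => x xU.
    rewrite (eq_bigl (fun y => y \in U :\ x)) => [|y].
      by rewrite sumr_const (cardsD1 x U) xU natrD addrAC subrr add0r.
    rewrite !inE andbC; have [yU|] := boolP (y \in U); rewrite ?andbF ?andbT //.
    have [->|yx] := eqVneq y x; first by rewrite e_irr.
    apply: contraNT complete => nexy; apply/existsP; exists x; apply/existsP; exists y.
    by rewrite xU yU eq_sym yx.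
  rewrite ler_pM2l //; apply => x y _ _ exy.
  by apply: contraTneq exy => ->; rewrite e_irr.
have U2 : (2 < #|U|)%N.
  have [y yU exy] := cut_connected_nbr cU xU U1.
  have yz : y != z by apply: contraTneq exy => ->.
  have yx : y != x by apply: contraTneq exy => ->; rewrite e_irr.
  have <- : #|[set x; y; z]| = 3%N.
    by rewrite -setUA cardsU1 cards2 !inE negb_or xz [x == y]eq_sym yx yz.
  by apply/subset_leq_card/subsetP => w; rewrite !inE => /orP[/orP[]|] /eqP->.
have [Msmall|Mbig] := leP (energy U (fun=> 0) (fun _ _ => 1)) ((#|U|%:R - 1) ^+ 2).
  apply: energy_averaging => // a v vU.
  have ltv : (#|U :\ v| < m)%N by move: (cardsD1 v U); rewrite vU; lia.
  have := IH _ _ _ ltv _ (cD v vU) (psd_scale a (psd_sub (subD1set _ _) psdU)).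
  rewrite (cardsD1 v U) vU natrD mulr1n => bound.
  by apply: le_trans (bound _); [lra | move=> y y'; rewrite t_sym].
have cardz : #|U :\ z| = #|U|.-1 by rewrite (cardsD1 z U) zU.
have k2 : (1 < #|U :\ z|)%N by rewrite cardz; lia.
(* The non-adjacent [x] and [z] share a colour, so k = n - 1, and [Mbig] says M > k (n - 1). *)
pose c y := if y == z then x else y.
have cU' : {in U, forall y, c y \in U :\ z}.
  by move=> y yU; rewrite /c !inE; case: (eqVneq y z) => [_|yz]; rewrite ?xz ?xU ?yz ?yU.
have proper_c : {in U &, forall y y', e y y' -> c y != c y'}.
  move=> y y' yU y'U; apply: contraTneq; rewrite /c.
  case: eqVneq => [->|_]; case: eqVneq => [->|_]; rewrite ?e_irr //.
  - by move=> <-; rewrite e_sym.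
  - by move=> ->.
  - by move=> ->; rewrite e_irr.
have := energy_coloring psdU cU' proper_c k2.
have -> : #|U :\ z|%:R = #|U|%:R - 1 :> R by rewrite (cardsD1 z U) zU natrD addrAC subrr add0r.
by move/(lt_le_trans Mbig) => /ltW; rewrite expr2 ler_pM2l ?subr_gt0 ?ltr1n.
Qed.

End Energy.

(** * Polynomials of a symmetric matrix and its spectrum *)

Lemma char_poly_conj (F : fieldType) (n : nat) (P A : 'M[F]_n) :
  P \in unitmx -> char_poly (invmx P *m A *m P) = char_poly A.
Proof.
move=> uP; rewrite /char_poly /char_poly_mx.
pose Q := map_mx polyC P; pose Q' := map_mx polyC (invmx P).
have QQ : Q' *m Q = 1%:M by rewrite -map_mxM mulVmx // map_mx1.
have -> : 'X%:M - map_mx polyC (invmx P *m A *m P)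
    = Q' *m ('X%:M - map_mx polyC A) *m Q.
  rewrite !map_mxM mulmxBr mulmxBl; congr (_ - _).
  by rewrite scalar_mxC -mulmxA QQ mulmx1.
by rewrite !det_mulmx mulrAC -det_mulmx QQ det1 mul1r.
Qed.

(** The matrix is unitarily diagonalisable over [R[i]], and the diagonal is a permutation of the
    eigenvalue list since both split the characteristic polynomial. *)
Lemma trace_horner_eigenvalues (R : realType) (n : nat) (A : 'M[R]_n.+1) (r : {poly R}) :
  A^T = A -> \tr (horner_mx A r) = \sum_(x <- eigenvalues A) r.[x].
Proof.
move=> symA; pose f : {rmorphism R -> R[i]} := real_complex R; pose B := map_mx f A.
have hermB : B \is hermsymmx.
  apply: realsym_hermsym; last first.
    by apply/mxOverP => i j; rewrite mxE; apply/complex_realP; exists (A i j).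
  by apply/is_hermitianmxP; rewrite expr0 scale1r map_mx_id // /B map_trmx symA.
have /orthomx_spectralP eqB := hermitian_normalmx hermB.
set d := spectral_diag B in eqB; set P := spectralmx B in eqB.
have uP : P \in unitmx := spectral_unit B.
have perm_d : perm_eq [seq f x | x <- eigenvalues A] [seq d 0 i | i <- enum 'I_n.+1].
  apply: prod_XsubC_eq; transitivity (map_poly f (char_poly A)).
    rewrite (char_poly_eigenvalues symA) rmorph_prod big_map /=.
    by apply: eq_bigr => x _; rewrite rmorphB /= map_polyX map_polyC.
  rewrite map_char_poly -/B eqB char_poly_conj // char_poly_trig ?diag_mx_is_trig //.
  by rewrite big_map big_enum; apply: eq_bigr => i _; rewrite mxE eqxx mulr1n.
apply: (fmorph_inj f); rewrite -trace_map_mx map_horner_mx -/B eqB.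
rewrite horner_mx_uconjC // mxtrace_mulC mulmxA mulmxV // mul1mx horner_mx_diag mxtrace_diag.
rewrite rmorph_sum /=; transitivity (\sum_(z <- [seq d 0 i | i <- enum 'I_n.+1]) (map_poly f r).[z]).
  by rewrite big_map big_enum; apply: eq_bigr => i _; rewrite mxE.
rewrite -(perm_big _ perm_d) big_map; apply: eq_bigr => x _.
by rewrite horner_map.
Qed.

(** Replaces a function on the spectrum by a polynomial, so that it can be applied to the matrix
    through [horner_mx]. *)
Lemma interpolation (F : fieldType) (s : seq F) (f : F -> F) :
  exists q : {poly F}, {in s, forall x, q.[x] = f x}.
Proof.
elim: s => [|x s [q qs]]; first by exists 0.
have [xs|xs] := boolP (x \in s).
  by exists q => y; rewrite inE => /orP[/eqP->|]; apply: qs.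
pose p := \prod_(y <- s) ('X - y%:P).
have px : p.[x] != 0 by rewrite -rootE root_prod_XsubC.
exists (q + ((f x - q.[x]) / p.[x]) *: p) => y; rewrite inE !hornerE.
case/orP => [/eqP->|ys]; first by rewrite divfK // addrC subrK.
have /eqP-> : root p y by rewrite root_prod_XsubC.
by rewrite mulr0 addr0 qs.
Qed.

Lemma tr_horner_mx (R : comNzRingType) (n : nat) (A : 'M[R]_n.+1) (p : {poly R}) :
  (horner_mx A p)^T = horner_mx A^T p.
Proof.
elim/poly_ind: p => [|p c IH]; first by rewrite !rmorph0 trmx0.
rewrite !rmorphD !rmorphM /= !horner_mx_X !horner_mx_C.
rewrite linearD /= tr_scalar_mx [_ * A]/(_ *m _) trmx_mul IH.
by congr (_ + _); apply/esym/comm_horner_mx.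
Qed.

(** * Distance from the adjacency matrix to a positive semidefinite matrix *)

Lemma energyT (R : realType) (I : finType) (e : rel I) (h : I -> R) (g : I -> I -> R) :
  energy e [set: I] h g = \sum_i (h i + \sum_j (if e i j then g i j else 0)).
Proof.
rewrite energyE big_split; congr (_ + _); first by apply: eq_bigr => i _; rewrite inE.
by apply: eq_bigr => i _; apply: eq_bigr => j _; rewrite !inE.
Qed.

(** The Hadamard square of the Gram matrix of vectors is the Gram matrix of their tensor squares,
    here [u] up to the factor [f i]. *)
Lemma gram_sqr_psd (R : realType) (m n : nat) (K : 'M[R]_(m, n)) (f : 'I_m -> R) :
  0 <= \sum_i \sum_j (K *m K^T) i j ^+ 2 * f i * f j.
Proof.
pose u (q : 'I_n * 'I_n) i := K i q.1 * K i q.2 * f i.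
have -> : \sum_i \sum_j (K *m K^T) i j ^+ 2 * f i * f j
    = \sum_(p : 'I_m * 'I_m) \sum_q u q p.1 * u q p.2.
  rewrite pair_bigA; apply: eq_bigr => -[i j] _ /=.
  rewrite expr2 !mxE big_distrlr /= pair_bigA -mulrA mulr_suml.
  by apply: eq_bigr => -[k l] _; rewrite /u !mxE /=; ring.
rewrite exchange_big; apply: sumr_ge0 => q _.
have -> : \sum_(p : 'I_m * 'I_m) u q p.1 * u q p.2 = (\sum_i u q i) ^+ 2.
  by rewrite expr2 big_distrlr pair_bigA.
exact: sqr_ge0.
Qed.

(** Symmetrising in i and j turns the sum into half the sum of w (f i - f j)^2. *)
Lemma laplacian_psd (R : realType) (I : finType) (w : I -> I -> R) (f : I -> R) :
  (forall i j, w i j = w j i) -> (forall i j, 0 <= w i j) ->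
  0 <= \sum_i \sum_j w i j * (f i ^+ 2 - f i * f j).
Proof.
move=> w_sym w_ge0; set T := \sum_i _.
have TT : T + T = \sum_i \sum_j w i j * (f i - f j) ^+ 2.
  rewrite {2}/T exchange_big -big_split; apply: eq_bigr => i _; rewrite -big_split.
  by apply: eq_bigr => j _ /=; rewrite [w j i]w_sym; ring.
suff : 0 <= T + T by lra.
rewrite TT; apply: sumr_ge0 => i _; apply: sumr_ge0 => j _.
by rewrite mulr_ge0 ?sqr_ge0.
Qed.

Lemma gram_dist_bound (R : realType) (n : nat) (e : rel 'I_n) (A K : 'M[R]_n) :
    symmetric e -> irreflexive e -> cut_connected e [set: 'I_n] ->
    (forall i j, A i j = A j i) -> (forall i j, e i j -> A i j ^+ 2 = 1) ->
    (forall i j, ~~ e i j -> A i j = 0) ->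
  n%:R - 1 <= \sum_i \sum_j ((K *m K^T) i j - A i j) ^+ 2.
Proof.
move=> e_sym e_irr conn A_sym Ae An; set X := K *m K^T.
have X_sym i j : X i j = X j i.
  by rewrite !mxE; apply: eq_bigr => k _; rewrite !mxE mulrC.
(* The pair i = j counts as a non-edge, so [mu i] includes [X i i ^+ 2], the diagonal entry of the
   Hadamard square. *)
pose t i j := A i j * X i j; pose w i j := if e i j then 0 else X i j ^+ 2.
pose mu i := \sum_j w i j.
have -> : \sum_i \sum_j (X i j - A i j) ^+ 2
    = energy e [set: 'I_n] mu (fun i j => (1 - t i j) ^+ 2).
  rewrite energyT; apply: eq_bigr => i _; rewrite -big_split /=.
  apply: eq_bigr => j _; rewrite /w /t; have [/Ae Aij|/An->] := boolP (e i j).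
    rewrite add0r; transitivity (A i j ^+ 2 * (1 - A i j * X i j) ^+ 2
      + (1 - A i j ^+ 2) * (X i j ^+ 2 * (1 + A i j ^+ 2) - 2 * A i j * X i j)).
      by ring.
    by rewrite Aij subrr mul0r addr0 mul1r.
  by rewrite subr0 addr0.
rewrite -[n in n%:R]card_ord -cardsT; apply: energy_bound => //.
  by move=> i j; rewrite /t A_sym X_sym.
move=> f; rewrite energyT.
have -> : \sum_i (mu i * f i ^+ 2
      + \sum_j (if e i j then t i j ^+ 2 * f i * f j else 0))
    = \sum_i \sum_j X i j ^+ 2 * f i * f j
      + \sum_i \sum_j w i j * (f i ^+ 2 - f i * f j).
  rewrite -big_split; apply: eq_bigr => i _ /=; rewrite mulr_suml -!big_split.
  apply: eq_bigr => j _ /=; rewrite /w /t; have [/Ae Aij|_] := boolP (e i j).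
    by rewrite exprMn Aij; ring.
  by ring.
apply: addr_ge0; first exact: gram_sqr_psd.
apply: laplacian_psd => i j; rewrite /w; last by case: ifP; rewrite ?sqr_ge0.
by rewrite e_sym X_sym.
Qed.

Lemma positive_eigenvalues_bound (R : realType) (n : nat) (e : rel 'I_n) (A : 'M[R]_n) :
    symmetric e -> irreflexive e -> cut_connected e [set: 'I_n] ->
    (forall i j, A i j = A j i) -> (forall i j, e i j -> A i j ^+ 2 = 1) ->
    (forall i j, ~~ e i j -> A i j = 0) ->
  \sum_(x <- eigenvalues A | 0 < x) x ^+ 2 <= \sum_i \sum_j A i j ^+ 2 - n%:R + 1.
Proof.
case: n => [|n] in e A * => e_sym e_irr conn A_sym Ae An.
  have /size0nil-> : size (eigenvalues A) = 0%N.
    by rewrite size_eigenvalues //; apply/matrixP => -[].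
  by rewrite big_nil big_ord0; lra.
have symA : A^T = A by apply/matrixP => i j; rewrite mxE.
(* [Num.sqrt] is 0 on negative reals, so q(x)^2 = max(x, 0) on the spectrum and [K *m K^T] is the
   positive part of [A]. *)
have [q qE] := interpolation (eigenvalues A) Num.sqrt.
pose K := horner_mx A q.
have KT : K^T = K by rewrite tr_horner_mx symA.
have frob (M : 'M[R]_n.+1) : M^T = M -> \sum_i \sum_j M i j ^+ 2 = \tr (M *m M).
  move=> MT; apply: eq_bigr => i _; rewrite mxE; apply: eq_bigr => j _.
  by rewrite -[in RHS]MT [X in _ * X]mxE MT expr2.
have := gram_dist_bound K e_sym e_irr conn A_sym Ae An.
have -> : \sum_i \sum_j ((K *m K^T) i j - A i j) ^+ 2
    = \tr (horner_mx A ((q ^+ 2 - 'X) ^+ 2)).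
  rewrite rmorphXn /= rmorphB /= rmorphXn /= horner_mx_X -/K KT.
  rewrite expr2 [_ * _]/(_ *m _) -frob; last by rewrite linearB /= expr2 [_ * _]/(_ *m _) trmx_mul KT symA.
  by apply: eq_bigr => i _; apply: eq_bigr => j _; rewrite !mxE.
have -> : \sum_i \sum_j A i j ^+ 2 = \tr (horner_mx A ('X ^+ 2)).
  by rewrite frob // rmorphXn /= horner_mx_X.
rewrite !trace_horner_eigenvalues //.
(* For each eigenvalue, x^2 = max(x, 0)^2 + (max(x, 0) - x)^2 with only one term nonzero at most. *)
suff -> : \sum_(x <- eigenvalues A) ('X ^+ 2).[x] =
    \sum_(x <- eigenvalues A | 0 < x) x ^+ 2
    + \sum_(x <- eigenvalues A) ((q ^+ 2 - 'X) ^+ 2).[x] by lra.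
rewrite [in RHS]big_mkcond -big_split /= !big_seq; apply: eq_bigr => x xA.
rewrite !hornerE qE //; have [x0|x0] := ltP 0 x.
  by rewrite sqr_sqrtr ?ltW // subrr expr0n addr0.
by rewrite ler0_sqrtr // expr0n sub0r sqrrN add0r.
Qed.

(** * Counting edges and passing to the signed graph *)

(** The ordered pairs with underlying edge {x, y} are exactly (x, y) and (y, x). *)
Lemma sum_adj (V : finType) (G : graph V) :
  \sum_(u : V) \sum_(v : V) (adj G u v : nat) = (2 * graph_size G)%N.
Proof.
rewrite pair_bigA /= -big_mkcond /=.
rewrite (partition_big (fun p : V * V => [set p.1; p.2]) (mem (edges G))) //=.
rewrite /graph_size mulnC -sum_nat_const; apply: eq_bigr => E EG.
have /eqP/cards2P[x [y [xy Exy]]] := card_edge EG.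
rewrite sum1_card -[RHS](_ : #|[set (x, y); (y, x)]| = 2%N); last first.
  by rewrite cards2 xpair_eqE negb_and xy.
apply: eq_card => -[u v]; rewrite !inE !xpair_eqE unfold_in /= Exy.
apply/andP/orP => [[_ /eqP/setP uvE]|].
  have uS : u \in [set x; y] by rewrite -uvE set21.
  have vS : v \in [set x; y] by rewrite -uvE set22.
  have xS : x \in [set u; v] by rewrite uvE set21.
  have yS : y \in [set u; v] by rewrite uvE set22.
  move: uS vS xS yS; rewrite !inE => /orP[]/eqP-> /orP[]/eqP->.
  - by rewrite [y == x]eq_sym (negPf xy).
  - by rewrite !eqxx; left.
  - by rewrite !eqxx; right.
  - by rewrite (negPf xy).
by case=> /andP[/eqP-> /eqP->]; rewrite /adj /= ?[[set y; _]]setUC -Exy.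
Qed.

Theorem theorem1p1 (R : realType) (V : finType) (Sigma : signed_graph V)
    (hSigma : graph_connected Sigma) :
  positive_square_energy R Sigma
    <= 2 * (graph_size Sigma)%:R - (graph_order Sigma)%:R + 1.
Proof.
pose e : rel 'I_#|V| := fun i j => adj Sigma (enum_val i) (enum_val j).
have e_sym : symmetric e by move=> i j; rewrite /e /adj /= setUC.
have e_irr : irreflexive e.
  move=> i; apply/negP => /card_edge; rewrite setUid cards1 => /eqP.
  by [].
set A := adjacency_matrix R Sigma.
have AE i j : A i j = if e i j then (sign Sigma [set enum_val i; enum_val j])%:~R else 0.
  by rewrite mxE.
have sqA i j : A i j ^+ 2 = (e i j)%:R.
  rewrite AE; case: ifP => [eij|_]; last by rewrite expr0n.
  by case: (sign_pm1 eij) => ->; rewrite ?mulrNz ?sqrrN expr1n.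
have conn : cut_connected e [set: 'I_#|V|].
  move=> S /properP[_ [b _ bS]] /set0Pn[a aS].
  have [/exists_inP[i iS /exists_inP[j jS eij]]|none] :=
    boolP [exists i in S, exists j in ~: S, e i j].
    by exists i, j; rewrite setTD.
  (* If no edge leaves [S], it is closed under adjacency, and the path from [a] to [b] cannot leave
     it. *)
  have clS : closed (adj Sigma) [pred v | enum_rank v \in S].
    have noexit u v : adj Sigma u v -> enum_rank u \in S -> enum_rank v \in S.
      move=> uv uS; apply: contraNT none => vS.
      apply/exists_inP; exists (enum_rank u) => //; apply/exists_inP.
      by exists (enum_rank v); rewrite ?inE // /e !enum_rankK.
    move=> u v uv; apply/idP/idP; first exact: noexit.
    by apply: noexit; move: uv; rewrite /adj /= setUC.
  have := closed_connect clS (hSigma (enum_val a) (enum_val b)).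
  by rewrite !inE !enum_valK aS (negPf bS).
have := @positive_eigenvalues_bound R _ e A e_sym e_irr conn.
have -> : \sum_i \sum_j A i j ^+ 2 = 2 * (graph_size Sigma)%:R.
  rewrite -natrM -sum_adj natr_sum (reindex _ (onW_bij _ (@enum_val_bij V))) /=.
  apply: eq_bigr => i _.
  rewrite natr_sum (reindex _ (onW_bij _ (@enum_val_bij V))) /=.
  by apply: eq_bigr => j _; rewrite sqA.
apply => [i j|i j eij|i j /negPf eij].
- by rewrite -[A in LHS]tr_adjacency_matrix mxE.
- by rewrite sqA eij.
- by rewrite AE eij.
Qed.
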